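(* Let $(\mathfrak{r},\mathfrak{p})$ be a finite local principal ring of length $v$ with residue field $\mathfrak{r}/\mathfrak{p} \cong \mathbb{F}_q$. Let $n,r \in \mathbb{Z}^+$, and for $1 \le j \le r$ let $v_j$ be an integer with $1 \le v_j \le v$. Let $\mathfrak{a}_1,\ldots,\mathfrak{a}_n,\mathfrak{b}_1,\ldots,\mathfrak{b}_r \subset \mathfrak{r}$ be nonempty subsets, each having the property that no two distinct elements are congruent modulo $\mathfrak{p}$. Let $f_1,\ldots,f_r \in \mathfrak{r}[t_1,\ldots,t_n]$. Let $$\mathfrak{z} = \Big\{x \in \prod_{i=1}^n \mathfrak{a}_i \;\Big|\; \forall\, 1 \le j \le r,\ f_j(x) \in \mathfrak{b}_j \pmod{\mathfrak{p}^{v_j}}\Big\}.$$ Then $\mathfrak{z} = \varnothing$ or $$\# \mathfrak{z} \ge \mathfrak{m}\Big(\# \mathfrak{a}_1,\ldots,\# \mathfrak{a}_n;\ \sum_{i=1}^n \# \mathfrak{a}_i - \sum_{j=1}^r (q^{v_j}-\# \mathfrak{b}_j)\deg f_j\Big).$$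
   Context: A principal ring is a commutative ring in which every ideal is principal; a ring is local if it has exactly one maximal ideal. For a finite local principal ring $(\mathfrak{r},\mathfrak{p})$ (with maximal ideal $\mathfrak{p}$), the length is the positive integer $v$ such that $\mathfrak{p}^{v-1} \ne (0)$ and $\mathfrak{p}^v = (0)$ (with $\mathfrak{p}^0=\mathfrak{r}$). For $n,a_1,\ldots,a_n \in \mathbb{Z}^+$ and an integer $N \le \sum_{i=1}^n a_i$, put $\mathfrak{m}(a_1,\ldots,a_n;N) = 1$ if $N < n$, and, if $n \le N \le \sum_{i=1}^n a_i$, let $\mathfrak{m}(a_1,\ldots,a_n;N)$ be the minimum of $\prod_{i=1}^n y_i$ over all $(y_1,\ldots,y_n) \in \mathbb{Z}^n$ with $1 \le y_i \le a_i$ for all $i$ and $\sum_{i=1}^n y_i = N$. For a ring $R$, a subset $B \subset R$, an ideal $I$ of $R$ and $x \in R$, ''$x \in B \pmod I$'' means that there is $b \in B$ with $x - b \in I$. $\deg$ denotes total degree; the zero polynomial is assigned degree $0$. *)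

(* Defs.v *)
From HB Require Import structures.
From mathcomp Require Import all_boot all_order all_algebra.
From mathcomp Require Import ring_quotient.
From mathcomp.multinomials Require Import mpoly.

Set Implicit Arguments.
Unset Strict Implicit.
Unset Printing Implicit Defensive.

Import Order.TTheory GRing.Theory Num.Theory.
Local Open Scope ring_scope.

Section Ideals.
Variable R : finComNzRingType.
Implicit Types I J M : {set R}.

(* Unlike [idealr R], which only contains proper ideals, this includes the
   unit ideal [setT], needed for the 0-th power of an ideal. *)
Definition is_ideal I : bool :=
  [&& 0 \in I, [forall x in I, forall y in I, x + y \in I]
    & [forall a, forall x in I, a * x \in I]].

Definition principal_ring : Prop :=
  forall I, is_ideal I -> exists a, I = [set x * a | x : R].

Definition maximal_ideal M : Prop :=
  [/\ is_ideal M, M != setT &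
      forall I, is_ideal I -> M \subset I -> I = M \/ I = setT].

Definition local_ring_with M : Prop :=
  maximal_ideal M /\ forall M', maximal_ideal M' -> M' = M.

Definition ideal_gen (A : {set R}) : {set R} :=
  \bigcap_(I : {set R} | is_ideal I && (A \subset I)) I.

Definition ideal_mul I J : {set R} :=
  ideal_gen [set x * y | x in I, y in J].

Definition ideal_exp I (k : nat) : {set R} := iter k (ideal_mul I) setT.

Definition ring_length I (v : nat) : Prop :=
  [/\ (0 < v)%N, ideal_exp I v.-1 != [set 0] & ideal_exp I v = [set 0]].

Definition in_mod (x : R) (B I : {set R}) : bool :=
  [exists b in B, x - b \in I].

Definition incongruent_mod (A I : {set R}) : Prop :=
  {in A &, forall x y, x - y \in I -> x = y}.

End Ideals.

(* [msize p] is 1 + the total degree of [p] when [p != 0], and 0 when [p = 0]. *)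
Definition tdeg (n : nat) (R : nzRingType) (p : {mpoly R[n]}) : nat :=
  (msize p).-1.

Definition admissible (n : nat) (a : 'I_n -> nat) (N : int)
    (y : 'I_n -> nat) : bool :=
  [forall i, 0 < y i <= a i]%N && (((\sum_i y i)%N : int) == N).

(* The default value of the iterated minimum bounds every product it ranges
   over, so it does not interfere as soon as an admissible [y] exists, that is,
   when n <= N <= \sum_i a i; see [minprodP]. *)
Definition minprod (n : nat) (a : 'I_n -> nat) (N : int) : nat :=
  if N < n%:Z then 1%N
  else (\big[minn/(\prod_i a i)%N]_(y : {ffun 'I_n -> 'I_(\sum_i a i).+1} |
          admissible a N (fun i => y i)) \prod_i y i)%N.

Lemma admissible_ex (n : nat) (a : 'I_n -> nat) (N : nat) :
  (forall i, 0 < a i)%N -> (n <= N)%N -> (N <= \sum_i a i)%N ->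
  exists y, admissible a N y.
Proof.
move=> a_gt0 leN; elim: N leN => [|N IH].
  rewrite leqn0 => /eqP n0 _; exists a; apply/andP; split.
    by apply/forallP => i; rewrite a_gt0 /=.
  by subst n; rewrite big_ord0.
rewrite leq_eqVlt => /orP[/eqP En _|].
  exists (fun=> 1%N); apply/andP; split; first by apply/forallP=> i /=; apply: a_gt0.
  by rewrite sum1_card card_ord -En.
rewrite ltnS => /IH{}IH ltN.
have [y /andP[/forallP yP /eqP [sy]]] := IH (ltnW ltN).
have [i ltyi] : exists i, (y i < a i)%N.
  apply/existsP; apply: contraLR ltN; rewrite negb_exists => /forallP h.
  by rewrite -leqNgt -sy; apply: leq_sum => i _; rewrite leqNgt.
exists (fun j => y j + (j == i))%N; apply/andP; split.
  apply/forallP => j; case: eqP => [->|_]; last by rewrite addn0.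
  by rewrite addn1 ltyi.
have s1 : (\sum_(j < n) (j == i) = 1)%N.
  by rewrite (bigD1 i) //= eqxx big1 // => j /negbTE ->.
by rewrite big_split /= sy s1 addn1.
Qed.

Lemma minprodP (n : nat) (a : 'I_n -> nat) (N : nat) :
  (forall i, 0 < a i)%N -> (n <= N)%N -> (N <= \sum_i a i)%N ->
  (exists2 y, admissible a N y & minprod a N = \prod_i y i)%N /\
  (forall y, admissible a N y -> minprod a N <= \prod_i y i)%N.
Proof.
move=> a_gt0 leN leNa; rewrite /minprod ltz_nat ltnNge leN /=.
set S := \sum_i a i; pose P := fun y : {ffun 'I_n -> 'I_S.+1} => admissible a N (fun i => y i).
have lift_adm y : admissible a N y ->
    exists2 z : {ffun 'I_n -> 'I_S.+1}, P z & forall i, z i = y i :> nat.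
  move=> /[dup] ay /andP[/forallP yP _].
  have E i : (inord (y i) : 'I_S.+1) = y i :> nat.
    rewrite inordK // ltnS; have /andP[_ /leq_trans->] // := yP i.
    by rewrite /S (bigD1 i) //= leq_addr.
  exists [ffun i => inord (y i)]; last by move=> i; rewrite ffunE.
  rewrite /P /admissible; under eq_forallb => i do rewrite ffunE E.
  by under eq_bigr => i _ do rewrite ffunE E.
have lower (z : {ffun 'I_n -> 'I_S.+1}) : P z ->
    (\big[minn/(\prod_i a i)%N]_(y | P y) \prod_i (y i : nat) <= \prod_i (z i : nat))%N.
  move=> Pz; have: z \in index_enum {ffun 'I_n -> 'I_S.+1} by exact: mem_index_enum.
  elim: (index_enum _) => // w s IH; rewrite inE big_cons.
  case/predU1P => [<-|/IH lez]; first by rewrite Pz geq_minl.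
  by case: ifP => // _; rewrite geq_min lez orbT.
split; last first.
  move=> y /lift_adm[z Pz zy]; apply: leq_trans (lower z Pz) _.
  by under eq_bigr => i _ do rewrite zy.
have [y0 /lift_adm[z0 Pz0 _]] := admissible_ex a_gt0 leN leNa.
case: (arg_minnP (fun z : {ffun 'I_n -> 'I_S.+1} => \prod_i (z i : nat))%N Pz0) => z Pz minz.
exists (fun i => z i : nat) => //; apply/eqP; rewrite eqn_leq lower //=.
apply: (big_ind (fun m => \prod_i (z i : nat) <= m)%N) => [|u w lu lw|y Py];
  [|by rewrite leq_min lu|exact: minz].
by apply: leq_prod => i _; case/andP: Pz => /forallP /(_ i) /andP[].
Qed.

(* Main.v *)
(* Write p = aR. A polynomial function of degree d on the grid whose values all
   lie in p is a * Q for a polynomial function Q of degree at most d: in the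
   Newton basis of the grid all its coefficients lie in p. If e is a section of
   the reduction R -> F_q that maps the image of b back to b, apply this to the
   product of all f - e c, which has degree q * deg f: where f is congruent to an
   element of b modulo p, f is in b modulo p^(k+1) iff Q is divisible by a^k.
   Iterating gives a polynomial of degree (q^(k+1) - #b) * deg f that is nonzero
   modulo p exactly where f is in b modulo p^(k+1). Multiplying these polynomials
   over all constraints reduces the theorem to the Alon-Furedi bound over F_q. *)

Require Import Defs.
From HB Require Import structures.
From mathcomp Require Import all_boot all_order all_algebra.
From mathcomp Require Import generic_quotient ring_quotient zify.
From mathcomp.multinomials Require Import mpoly.

Set Implicit Arguments.
Unset Strict Implicit.
Unset Printing Implicit Defensive.

Import Order.TTheory GRing.Theory Num.Theory.
Local Open Scope ring_scope.

(** * Newton polynomials on a list of nodes *)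

Section Newton.
Variable R : comNzRingType.
Implicit Types (s : seq R) (x : R).

(** Past the end of [s] the nodes default to [0], so that the product is monic of degree [k] in [x]
    for every [k]. *)
Definition newton s k x : R := \prod_(i < k) (x - s`_i).

Lemma newton0 s x : newton s 0 x = 1.
Proof. by rewrite /newton big_ord0. Qed.

Lemma newtonS s k x : newton s k.+1 x = newton s k x * (x - s`_k).
Proof. by rewrite /newton big_ord_recr. Qed.

Lemma newton_eq0 s k x : x \in take k s -> newton s k x = 0.
Proof.
move=> xs; have lt_k : (index x (take k s) < k)%N.
  by move: xs; rewrite -index_mem size_take_min leq_min => /andP[].
rewrite /newton (bigD1 (Ordinal lt_k)) //=.
by rewrite -(nth_take _ lt_k) nth_index // subrr mul0r.
Qed.

Lemma newton_oversize s k x : x \in s -> (size s <= k)%N -> newton s k x = 0.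
Proof. by move=> xs le_sk; rewrite newton_eq0 // take_oversize. Qed.

End Newton.

Lemma rmorph_newton (R S : comNzRingType) (rho : {rmorphism R -> S})
    (s : seq R) k x :
  rho (newton s k x) = newton (map rho s) k (rho x).
Proof.
rewrite /newton rmorph_prod; apply: eq_bigr => i _; rewrite rmorphB.
congr (_ - _); have [lt_is|le_si] := ltnP i (size s).
  by rewrite (nth_map 0).
by rewrite !nth_default ?size_map // rmorph0.
Qed.

Lemma newton_neq0 (F : fieldType) (s : seq F) k :
  uniq s -> (k < size s)%N -> newton s k s`_k != 0.
Proof.
move=> s_uniq lt_ks; rewrite prodf_seq_neq0; apply/allP => i _ /=.
by rewrite subr_eq0 nth_uniq ?(ltn_trans (ltn_ord i)) // gtn_eqF.
Qed.

(** The sum is a polynomial of degree exactly [k] with leading coefficient [c k], so at most [k] of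
    the distinct points of [s] are roots. *)
Lemma count_newton_neq0 (F : fieldType) (s : seq F) (c : nat -> F) k :
  uniq s -> c k != 0 ->
  (size s - k <= count (fun x => \sum_(j < k.+1) newton s j x * c j != 0)%R s)%N.
Proof.
move=> s_uniq ck_neq0.
pose P := \sum_(j < k.+1) c j *: \prod_(i < j) ('X - (s`_i)%:P).
have hornerP x : P.[x] = \sum_(j < k.+1) newton s j x * c j.
  rewrite horner_sum; apply: eq_bigr => j _; rewrite hornerZ mulrC.
  by congr (_ * _); rewrite horner_prod; apply: eq_bigr => i _; rewrite !hornerE.
have sizeN j : size (\prod_(i < j) ('X - (s`_i)%:P)) = j.+1.
  by rewrite -(big_enum _ _ 'I_j) size_prod_XsubC size_enum_ord.
have leadP : size P = k.+1.
  rewrite /P big_ord_recr /= addrC size_polyDl /= size_scale ?sizeN // ltnS.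
  apply: leq_trans (size_sum _ _ _) _; apply/bigmax_leqP => j _.
  by apply: leq_trans (size_scale_leq _ _) _; rewrite sizeN.
rewrite -(count_predC (root P)) leq_subLR.
have <- : count (predC (root P)) s
    = count (fun x => \sum_(j < k.+1) newton s j x * c j != 0) s.
  by apply: eq_count => x /=; rewrite rootE hornerP.
rewrite leq_add2r -size_filter -ltnS -leadP.
by apply: max_poly_roots; rewrite ?filter_all ?filter_uniq // -size_poly_eq0 leadP.
Qed.

(** * Functions of bounded degree on a grid *)

Section GridDegree.
Variable R : comNzRingType.
Implicit Types (s xs : seq R) (A : seq (seq R)) (g h : seq R -> R).

Definition grid A : seq (seq R) :=
  foldr (fun s G => [seq x :: xs | x <- s, xs <- G]) [:: [::]] A.

Lemma mem_grid_cons s A x xs :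
  (x :: xs \in grid (s :: A)) = (x \in s) && (xs \in grid A).
Proof.
apply/allpairsP/andP => [[[y ys] [/= ys_s ysA [-> ->]]]|[xs_s xsA]] //.
by exists (x, xs).
Qed.

Lemma gridP s A xs : xs \in grid (s :: A) ->
  exists x ys, [/\ xs = x :: ys, x \in s & ys \in grid A].
Proof. by case/allpairsP => -[x ys] [/= ? ? ->]; exists x, ys. Qed.

Lemma grid_uniq A : all uniq A -> uniq (grid A).
Proof.
elim: A => //= s A IH /andP[s_uniq /IH A_uniq].
by apply: allpairs_uniq => // -[x xs] [y ys] _ _ [-> ->].
Qed.

Lemma grid_nthP A xs :
  reflect (size xs = size A /\
           forall i, (i < size A)%N -> xs`_i \in nth [::] A i)
          (xs \in grid A).
Proof.
elim: A xs => [|s A IH] [|x xs]; rewrite ?mem_grid_cons.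
- by rewrite /= inE eqxx; constructor.
- by rewrite /= inE; constructor => -[].
- by apply: (iffP idP) => [/gridP[? [? []]]|[]].
apply: (iffP andP) => [[xs_s /IH[sz nthA]]|[[sz] nthA]].
  by split=> [|[|i]] /=; rewrite ?sz // ltnS; apply: nthA.
by split; [apply: (nthA 0%N)|apply/IH; split=> // i; apply: (nthA i.+1)].
Qed.

(* The Newton basis [1], [x - s`_0], [(x - s`_0) * (x - s`_1)], ... is adapted to
   the points [s]: the terms beyond [size s] vanish on
   [s], so no separate reduction modulo [\prod_(a <- s) ('X - a)] is needed. *)
Fixpoint gdeg A (d : nat) g : Prop :=
  if A is s :: A' then
    exists2 h : nat -> seq R -> R, (forall k, (k <= d)%N -> gdeg A' (d - k) (h k))
      & forall x xs, x \in s -> xs \in grid A' ->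
          g (x :: xs) = \sum_(k < d.+1) newton s k x * h k xs
  else True.

Lemma gdeg_ext A d g g' : {in grid A, g =1 g'} -> gdeg A d g -> gdeg A d g'.
Proof.
case: A => //= s A gg' [h deg_h gE]; exists h => // x xs xs_s xsA.
by rewrite -gE // gg' // mem_grid_cons xs_s.
Qed.

Lemma gdeg0 A d : gdeg A d (fun=> 0).
Proof.
elim: A d => //= s A IH d; exists (fun _ _ => 0) => // x xs _ _.
by rewrite big1 // => k _; rewrite mulr0.
Qed.

Lemma gdegD A d g g' :
  gdeg A d g -> gdeg A d g' -> gdeg A d (fun xs => g xs + g' xs).
Proof.
elim: A d g g' => //= s A IH d g g' [h deg_h gE] [h' deg_h' g'E].
exists (fun k xs => h k xs + h' k xs) => [k le_kd|x xs xs_s xsA].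
  by apply: IH; [apply: deg_h|apply: deg_h'].
by rewrite gE // g'E // -big_split; apply: eq_bigr => k _; rewrite mulrDr.
Qed.

Lemma gdeg_sum A d (I : eqType) (r : seq I) (G : I -> seq R -> R) :
  (forall i, i \in r -> gdeg A d (G i)) ->
  gdeg A d (fun xs => \sum_(i <- r) G i xs).
Proof.
elim: r => [|i r IH] deg_G.
  by apply: gdeg_ext (gdeg0 A d) => xs _; rewrite big_nil.
apply: (@gdeg_ext _ _ (fun xs => G i xs + \sum_(j <- r) G j xs)).
  by move=> xs _; rewrite big_cons.
apply: gdegD; first by apply: deg_G; rewrite mem_head.
by apply: IH => j jr; apply: deg_G; rewrite inE jr orbT.
Qed.

(** Single Newton terms are the building blocks: weakening, scaling and multiplication expand a
    function by [gdeg_expand], treat one term at a time and add up with [gdeg_sum]. *)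
Lemma gdeg_newton s A k d g : (k <= d)%N -> gdeg A (d - k) g ->
  gdeg (s :: A) d (fun xs => newton s k (head 0 xs) * g (behead xs)).
Proof.
move=> le_kd deg_g; exists (fun j => if j == k then g else fun=> 0).
  by move=> j le_j; case: eqP => [->|_] //; apply: gdeg0.
move=> x xs _ _ /=; have lt_k : (k < d.+1)%N by [].
rewrite (bigD1 (Ordinal lt_k)) //= eqxx big1 ?addr0 // => j /negbTE.
by rewrite -val_eqE /= => ->; rewrite mulr0.
Qed.

Lemma gdeg_expand s A d g : gdeg (s :: A) d g ->
  exists2 h : nat -> seq R -> R, (forall k, (k <= d)%N -> gdeg A (d - k) (h k))
    & {in grid (s :: A), g =1 fun xs =>
         \sum_(k < d.+1) newton s k (head 0 xs) * h k (behead xs)}.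
Proof.
case=> h deg_h gE; exists h => // xs /gridP[x [ys [-> xs_s ysA]]].
exact: gE.
Qed.

Lemma gdegW A d e g : (d <= e)%N -> gdeg A d g -> gdeg A e g.
Proof.
elim: A d e g => // s A IH d e g le_de /gdeg_expand[h deg_h gE].
apply: gdeg_ext (fun xs xsA => esym (gE xs xsA)) _.
apply: gdeg_sum => k _; have le_kd : (k <= d)%N by rewrite -ltnS.
apply: (@gdeg_newton s A k e _ (leq_trans le_kd le_de)).
by apply: IH (deg_h _ le_kd); rewrite leq_sub2r.
Qed.

Lemma gdeg_const A d c : gdeg A d (fun=> c).
Proof.
apply: gdegW (leq0n d) _; elim: A => // s A IH.
apply: gdeg_ext (gdeg_newton s (leqnn 0) IH) => xs _.
by rewrite newton0 mul1r.
Qed.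

Lemma gdegZ A c d g : gdeg A d g -> gdeg A d (fun xs => c * g xs).
Proof.
elim: A d g => // s A IH d g /gdeg_expand[h deg_h gE].
apply: (@gdeg_ext _ _ (fun xs => \sum_(k < d.+1)
    newton s k (head 0 xs) * (c * h k (behead xs)))).
  by move=> xs xsA; rewrite gE // mulr_sumr; apply: eq_bigr => k _; rewrite mulrCA.
apply: gdeg_sum => k _; have le_kd : (k <= d)%N by rewrite -ltnS.
exact: (@gdeg_newton s A k d (fun ys => c * h k ys) le_kd (IH _ _ (deg_h k le_kd))).
Qed.

(** Multiplication by the coordinate turns the [k]-th Newton polynomial into the next one plus the
    [k]-th node times itself, so the degree bound rises by one. *)
Lemma gdeg_head s A d g :
  gdeg (s :: A) d g ->
  gdeg (s :: A) d.+1 (fun xs => head 0 xs * g xs).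
Proof.
move=> /gdeg_expand[h deg_h gE].
apply: (@gdeg_ext _ _ (fun xs => \sum_(k < d.+1)
    (newton s k.+1 (head 0 xs) * h k (behead xs)
     + newton s k (head 0 xs) * (s`_k * h k (behead xs))))).
  move=> xs xsA; rewrite gE // mulr_sumr; apply: eq_bigr => k _.
  by rewrite newtonS mulrA -mulrDl mulrCA mulrA -mulrDr subrK mulrC mulrA.
apply: gdeg_sum => k _; have le_kd : (k <= d)%N by rewrite -ltnS.
apply: gdegD.
  exact: (@gdeg_newton s A k.+1 d.+1 _ le_kd (deg_h _ le_kd)).
apply: gdegW (leqnSn d) _.
exact: (@gdeg_newton s A k d (fun ys => s`_k * h k ys) le_kd (gdegZ _ (deg_h k le_kd))).
Qed.

Lemma gdegM A d e g g' :
  gdeg A d g -> gdeg A e g' -> gdeg A (d + e) (fun xs => g xs * g' xs).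
Proof.
elim: A d e g g' => // s A IH d e g g' /gdeg_expand[h deg_h gE].
move=> /gdeg_expand[h' deg_h' g'E].
(* A product of two Newton polynomials has to be expanded again. The factors of the first are
   multiplied in one by one: the coordinate costs one degree, the scalar [- s_i] none. *)
have deg_newtonM i j m u : gdeg A m u -> gdeg (s :: A) (i + (j + m))
    (fun xs => newton s i (head 0 xs) * (newton s j (head 0 xs) * u (behead xs))).
  move=> deg_u; elim: i => [|i IHi].
    apply: gdeg_ext (gdeg_newton s (leq_addr m j) _) => [xs _|].
      by rewrite newton0 mul1r.
    by rewrite addKn; apply: deg_u.
  apply: gdeg_ext; last first.
    apply: gdegD; first exact: (gdeg_head IHi).
    by apply: gdegW (leqnSn _) _; apply: (gdegZ (- s`_i)) IHi.
  by move=> xs _ /=; rewrite -mulrDl newtonS !mulrA [_ * (_ - _)]mulrC.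
apply: (@gdeg_ext _ _ (fun xs => \sum_(i < d.+1) \sum_(j < e.+1)
    newton s i (head 0 xs) * (newton s j (head 0 xs)
      * (h i (behead xs) * h' j (behead xs))))).
  move=> xs xsA; rewrite gE // g'E // mulr_suml; apply: eq_bigr => i _.
  rewrite mulr_sumr; apply: eq_bigr => j _; rewrite -!mulrA.
  by congr (_ * _); rewrite mulrCA.
apply: gdeg_sum => i _; apply: gdeg_sum => j _.
have le_id : (i <= d)%N by rewrite -ltnS.
have le_je : (j <= e)%N by rewrite -ltnS.
have -> : (d + e = i + (j + (d - i + (e - j))))%N.
  by rewrite addnCA (addnA i) subnKC // addnCA subnKC.
apply: (deg_newtonM i j _ (fun xs => h i xs * h' j xs)).
by apply: IH; [apply: deg_h|apply: deg_h'].
Qed.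

Lemma gdeg_prod A (I : Type) (r : seq I) (P : pred I) (d : I -> nat) (G : I -> seq R -> R) :
  (forall i, P i -> gdeg A (d i) (G i)) ->
  gdeg A (\sum_(i <- r | P i) d i) (fun xs => \prod_(i <- r | P i) G i xs).
Proof.
move=> deg_G; elim: r => [|i r IH].
  by rewrite big_nil; apply: gdeg_ext (gdeg_const A 0 1) => xs _; rewrite big_nil.
rewrite big_cons; case: ifP => [Pi|nPi].
  by apply: gdeg_ext (gdegM (deg_G _ Pi) IH) => xs _; rewrite big_cons Pi.
by apply: gdeg_ext IH => xs _; rewrite big_cons nPi.
Qed.

Lemma gdeg_nth A i : gdeg A 1 (fun xs => xs`_i).
Proof.
elim: A i => // s A IH [|i].
  apply: gdeg_ext (gdeg_head (gdeg_const (s :: A) 0 1)).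
  by move=> xs _; rewrite mulr1 nth0.
apply: gdeg_ext (gdeg_newton s (leq0n 1) (IH i)) => xs _.
by rewrite newton0 mul1r nth_behead.
Qed.

Lemma gdeg_meval n A (f : {mpoly R[n]}) :
  gdeg A (tdeg f) (fun xs => f.@[fun i => xs`_i]).
Proof.
apply: (@gdeg_ext _ _ (fun xs => \sum_(m <- msupp f)
    f@_m * \prod_(i < n) xs`_i ^+ m i)) => [xs _|].
  by rewrite mevalE.
apply: gdeg_sum => m mf; apply: gdegZ.
(* The support contains [m], so [msize f] is positive and its predecessor is a true degree. *)
have le_m : (mdeg m <= tdeg f)%N.
  by rewrite /tdeg -ltnS (ltn_predK (msize_mdeg_lt mf)) msize_mdeg_lt.
apply: gdegW le_m _; rewrite mdegE; apply: gdeg_prod => i _.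
elim: (m i) => [|k IHk]; first exact: gdeg_const.
rewrite -add1n; apply: gdeg_ext (gdegM (gdeg_nth A i) IHk) => xs _.
by rewrite exprS.
Qed.

End GridDegree.

(** * Reduction to the residue field: division and counting of nonzeros *)

Section Residue.
Variables (R : comNzRingType) (F : fieldType) (rho : {rmorphism R -> F}).
Implicit Types (s xs : seq R) (A : seq (seq R)) (g h : seq R -> R).

Definition residually_uniq A := all (fun s => uniq (map rho s)) A.

Lemma residue_newton_sum s (c : nat -> R) d k : uniq (map rho s) ->
  (k < size s)%N -> (k <= d)%N ->
  (forall j, (j < k)%N -> rho (c j) = 0) ->
  rho (\sum_(j < d.+1) newton s j s`_k * c j)
    = newton (map rho s) k (map rho s)`_k * rho (c k).
Proof.
move=> s_uniq lt_ks le_kd c0; rewrite rmorph_sum.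
have lt_kd : (k < d.+1)%N by [].
rewrite (bigD1 (Ordinal lt_kd)) //= big1 ?addr0 => [|j].
  by rewrite rmorphM rmorph_newton (nth_map 0).
rewrite -val_eqE /= rmorphM neq_ltn => /orP[/c0 ->|lt_kj]; first by rewrite mulr0.
rewrite newton_eq0 ?rmorph0 ?mul0r // -(nth_take _ lt_kj) mem_nth //.
by rewrite size_take_min leq_min lt_kj.
Qed.

(** Evaluation at the nodes in their order gives a triangular system over [F]; its diagonal entries
    are nonzero because the nodes stay distinct under [rho]. *)
Lemma newton_coef_residue0 s (c : nat -> R) d k : uniq (map rho s) ->
  (forall x, x \in s -> rho (\sum_(j < d.+1) newton s j x * c j) = 0) ->
  (k < size s)%N -> (k <= d)%N -> rho (c k) = 0.
Proof.
move=> s_uniq sum0; elim/ltn_ind: k => k IH lt_ks le_kd.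
have c0 j : (j < k)%N -> rho (c j) = 0.
  by move=> lt_jk; apply: IH => //; [apply: ltn_trans lt_ks|apply/ltnW/(leq_trans lt_jk)].
have := sum0 _ (mem_nth 0 lt_ks); rewrite residue_newton_sum //.
move/eqP; rewrite mulf_eq0 (negPf (newton_neq0 _ _)) ?size_map //.
by move/eqP.
Qed.

(** Division by [a] is done on the Newton coefficients, which preserves the degree bound: at each
    point of the remaining grid the triangular system makes them residually zero, so induction
    applies to them. *)
Lemma gdeg_div A d g (a : R) : residually_uniq A ->
  (forall x, rho x = 0 -> exists y, x = a * y) ->
  gdeg A d g -> {in grid A, forall xs, rho (g xs) = 0} ->
  exists2 Q, gdeg A d Q & {in grid A, forall xs, g xs = a * Q xs}.
Proof.
move=> + ker_rho; elim: A d g => [|s A IH] d g.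
  move=> _ _ /(_ [::]) /(_ isT)/ker_rho[y gE]; exists (fun=> y) => // xs.
  by rewrite inE => /eqP ->.
move=> /andP[s_uniq A_uniq] [h deg_h gE] g0.
have /fin_all_exists[Q QP] (k : 'I_d.+1) : exists Q, gdeg A (d - k) Q /\
    ((k < size s)%N -> {in grid A, forall xs, h k xs = a * Q xs}).
  have le_kd : (k <= d)%N by rewrite -ltnS.
  (* From index [size s] on, the values on [s] say nothing about the coefficient. It is kept as it
     is, since its Newton polynomial vanishes on [s]. *)
  have [lt_ks|_] := ltnP k (size s); last by exists (h k); split=> //; apply: deg_h.
  have [xs xsA|Q deg_Q QE] := IH _ _ A_uniq (deg_h k le_kd); last by exists Q.
  apply: (@newton_coef_residue0 s (fun k => h k xs) d) => // x xs_s.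
  by rewrite -gE // g0 // mem_grid_cons xs_s.
exists (fun xs => \sum_(k < d.+1) newton s k (head 0 xs) * Q k (behead xs)).
  apply: gdeg_sum => k _; have [deg_Q _] := QP k.
  by apply: (@gdeg_newton _ s A k d (Q k)); rewrite // -ltnS.
move=> _ /gridP[x [xs [-> xs_s xsA]]]; rewrite gE // mulr_sumr.
apply: eq_bigr => k _ /=; have [_ QE] := QP k.
have [lt_ks|le_sk] := ltnP k (size s); first by rewrite QE // mulrCA.
by rewrite newton_oversize // !mul0r mulr0.
Qed.

Lemma count_grid_cons (P : pred (seq R)) s A :
  count P (grid (s :: A)) = (\sum_(xs <- grid A) count (fun x => P (x :: xs)) s)%N.
Proof.
rewrite -sum1_count big_mkcond big_allpairs_dep exchange_big /=.
by apply: eq_bigr => xs _; rewrite -sum1_count [RHS]big_mkcond.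
Qed.

(* The top Newton coefficient [h k] that is not residually zero has degree at
   most [d - k]; over each of its residual nonzeros, [g] is a univariate
   polynomial of residual degree [k], with at least [size s - k] nonzeros. *)
Lemma alon_furedi A d g : residually_uniq A -> gdeg A d g ->
  has (fun xs => rho (g xs) != 0) (grid A) ->
  exists y : seq nat,
    [/\ size y = size A,
        forall i, (i < size A)%N -> (0 < nth 0 y i <= size (nth [::] A i))%N,
        (sumn (map size A) <= sumn y + d)%N
      & (\prod_(i <- y) i <= count (fun xs => rho (g xs) != 0)%R (grid A))%N].
Proof.
elim: A d g => [|s A IH] d g.
  move=> _ _ g_neq0; exists [::]; split => //.
  by rewrite big_nil -has_count.
move=> /andP[s_uniq A_uniq] [h deg_h gE] /hasP[_ /gridP[x0 [xs0 [-> x0s xs0A]]] g_neq0].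
pose top k := [&& (k <= d)%N, (k < size s)%N
  & has (fun xs => rho (h k xs) != 0) (grid A)].
have ex_top : exists k, top k.
  (* Some term of the expansion is residually nonzero at the given point; its index is below
     [size s], as later Newton polynomials vanish on [s]. *)
  case: (pickP (fun k : 'I_d.+1 => rho (newton s k x0 * h k xs0) != 0)) => [k|no_k].
    rewrite rmorphM mulf_eq0 negb_or => /andP[N_neq0 hk_neq0]; exists k.
    apply/and3P; split; [by rewrite -ltnS| |by apply/hasP; exists xs0].
    by rewrite ltnNge; apply: contra N_neq0 => /newton_oversize->; rewrite ?rmorph0.
  move: g_neq0; rewrite gE // rmorph_sum big1 ?eqxx // => k _.
  by have /negbFE/eqP := no_k k.
have top_le k : top k -> (k <= d)%N by case/and3P.
case: (ex_maxnP ex_top top_le) => k /and3P[le_kd lt_ks hk_neq0] k_max.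
have [y [sz_y yA sum_y prod_y]] := IH _ _ A_uniq (deg_h k le_kd) hk_neq0.
exists ((size s - k)%N :: y); split.
- by rewrite /= sz_y.
- by case=> [_|i]; [rewrite /= subn_gt0 lt_ks leq_subr|apply: yA].
- have -> : (sumn ((size s - k)%N :: y) + d = size s + (sumn y + (d - k)))%N.
    rewrite /=; lia.
  by rewrite /= leq_add2l.
rewrite big_cons count_grid_cons.
apply: leq_trans (leq_mul (leqnn _) prod_y) _.
rewrite -sum1_count big_mkcond big_distrr big_seq [leqRHS]big_seq /=.
apply: leq_sum => xs xsA.
case: ifP => [hk_xs|_]; last by rewrite muln0.
rewrite muln1 -(size_map rho s).
apply: leq_trans (@count_newton_neq0 _ _ (fun j => rho (h j xs)) _ s_uniq hk_xs) _.
rewrite count_map; apply: eq_leq; apply: eq_in_count => x xs_s /=.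
(* The terms beyond [k] drop out residually: either the Newton polynomial vanishes on [s], or the
   coefficient is residually zero by maximality of [k]. *)
rewrite gE // rmorph_sum (big_ord_widen d.+1
  (fun j => newton (map rho s) j (rho x) * rho (h j xs))) //.
rewrite [in LHS]big_mkcond; congr (_ != 0); apply: eq_bigr => j _.
rewrite rmorphM rmorph_newton; case: ltnP => // lt_kj.
have [lt_js|le_sj] := ltnP j (size s); last first.
  by rewrite newton_oversize ?mul0r ?size_map ?map_f.
have /negP : ~~ top j by apply/negP => /k_max; rewrite leqNgt lt_kj.
rewrite /top -ltnS ltn_ord lt_js /= => no_h; apply/esym/eqP; rewrite mulf_eq0.
apply/orP; right; apply/negPn/negP => hj; apply: no_h.
by apply/hasP; exists xs.
Qed.

End Residue.

(** * Divisibility by powers of a generator of the maximal ideal *)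

Definition divides (R : comNzRingType) (x y : R) := exists z, y = x * z.

Section Uniformizer.
Variables (R : finComNzRingType) (F : finFieldType) (rho : {rmorphism R -> F}).
Variables (a : R) (v : nat).
Hypothesis rho_surj : forall c, exists x, rho x = c.

Hypothesis ker_rho : forall x, rho x = 0 <-> divides a x.
Hypotheses (v_gt0 : (0 < v)%N) (aX0 : a ^+ v = 0) (aX_neq0 : a ^+ v.-1 != 0).

(** Up to a factor [c], the element [x] is [1 - a * m] with [a * m] nilpotent, and the geometric
    series inverts it. *)
Lemma residue_unit x : rho x != 0 -> exists y, x * y = 1.
Proof.
move=> x_neq0; have [c rho_c] := rho_surj (rho x)^-1.
have /ker_rho[m mE] : rho (1 - x * c) = 0.
  by rewrite rmorphB rmorphM rmorph1 rho_c divff ?subrr.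
exists (c * \sum_(i < v) (a * m) ^+ i).
rewrite mulrA -[x * c](subKr 1) mE -[1 - _]opprB mulNr -subrX1.
by rewrite exprMn aX0 mul0r sub0r opprK.
Qed.

(** Inductively [z = a ^ j * t]. If [t] is a unit, [a * z = 0] gives [a ^ j.+1 = 0], against
    [a ^ v.-1 != 0]; otherwise [a] divides [t]. *)
Lemma annihilator_divides j z : (j < v)%N -> a * z = 0 -> divides (a ^+ j) z.
Proof.
elim: j => [|j IH] lt_jv az0; first by exists z; rewrite mul1r.
have [t zE] := IH (ltnW lt_jv) az0.
have [/ker_rho[t' tE]|/residue_unit[u tu]] := eqVneq (rho t) 0.
  by exists t'; rewrite zE tE mulrA -exprSr.
have aj0 : a ^+ j.+1 = 0.
  by rewrite exprS -[a ^+ j]mulr1 -tu (mulrA (a ^+ j)) -zE mulrA az0 mul0r.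
have le_jv : (j.+1 <= v.-1)%N by rewrite -ltnS (prednK v_gt0).
by case/negP: aX_neq0; rewrite -(subnKC le_jv) exprD aj0 mul0r.
Qed.

(** Cancelling [a] leaves an error annihilated by [a]; for [k < v] this error is itself a multiple
    of [a ^ k]. *)
Lemma dividesS_cancel k w : (k < v)%N ->
  divides (a ^+ k.+1) (a * w) <-> divides (a ^+ k) w.
Proof.
move=> lt_kv; split=> [[y awE]|[y ->]]; last by exists y; rewrite mulrA -exprS.
have [t tE] : divides (a ^+ k) (w - a ^+ k * y).
  by apply: annihilator_divides; rewrite // mulrBr awE mulrA -exprS subrr.
by exists (y + t); rewrite mulrDr -tE addrC subrK.
Qed.

Lemma exists_section (b : {set R}) : {in b &, injective rho} ->
  exists2 e : F -> R, cancel e rho & forall x, x \in b -> e (rho x) = x.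
Proof.
move=> b_inj; have /fin_all_exists[e eP] (c : F) : exists x, rho x = c /\
    forall y, y \in b -> rho y = c -> x = y.
  case: (pickP [pred y in b | rho y == c]) => [x /andP[xb /eqP <-]|no_b].
    by exists x; split=> // y yb /b_inj->.
  have [x xE] := rho_surj c; exists x; split=> // y yb yc.
  by have := no_b y; rewrite /= yb yc eqxx.
exists e => [c|x xb]; first by have [] := eP c.
by have [_] := eP (rho x); apply.
Qed.

(** * Polynomial tests for congruence conditions *)

Variable A : seq (seq R).
Hypothesis A_uniq : residually_uniq rho A.

(** For [k = 1] this is the role that [1 - f ^ (q - 1)] plays over a field with [q] elements. *)
Definition power_test k := forall d f, gdeg A d f ->
  exists2 G, gdeg A ((#|F| ^ k - 1) * d) G
    & {in grid A, forall xs, rho (G xs) != 0 <-> divides (a ^+ k) (f xs)}.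

(* The values of [\prod_(c : F) (f - e c)] all lie in the maximal ideal, so this
   function is [a * Q] with [Q] of degree [q * deg f]. Where [f] is congruent to
   some [b0] in [b], all factors but [f - b0] are units, and [Q] is divisible by
   [a ^+ k] exactly when [f - b0] is divisible by [a ^+ k.+1]. *)
Lemma set_test k (b : {set R}) d f : power_test k -> (k < v)%N ->
  {in b &, injective rho} -> gdeg A d f ->
  exists2 G, gdeg A ((#|F| ^ k.+1 - #|b|) * d) G
    & {in grid A, forall xs, rho (G xs) != 0 <->
         exists2 b0, b0 \in b & divides (a ^+ k.+1) (f xs - b0)}.
Proof.
move=> test_k lt_kv b_inj deg_f; have [e eK e_b] := exists_section b_inj.
have deg_fe c : gdeg A d (fun xs => f xs - e c).
  by apply: gdegD => //; apply: gdeg_const.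
have deg_prod (P : pred F) : gdeg A (#|P| * d) (fun xs => \prod_(c | P c) (f xs - e c)).
  by rewrite -sum_nat_const; apply: gdeg_prod => c _; apply: deg_fe.
have rho_factor c xs : rho (f xs - e c) = rho (f xs) - c by rewrite rmorphB eK.
have [Q deg_Q QE] : exists2 Q, gdeg A (#|F| * d) Q &
    {in grid A, forall xs, \prod_c (f xs - e c) = a * Q xs}.
  apply: gdeg_div A_uniq _ (deg_prod predT) _ => [x /ker_rho //|xs _].
  by rewrite rmorph_prod (bigD1 (rho (f xs))) //= rho_factor subrr mul0r.
have [G deg_G GE] := test_k _ _ deg_Q.
pose B := rho @: b; have cardB : #|B| = #|b| by rewrite card_in_imset.
exists (fun xs => \prod_(c in ~: B) (f xs - e c) * G xs).
  have le_bq : (#|b| <= #|F|)%N by rewrite -cardB max_card.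
  have q_gt0 : (0 < #|F| ^ k)%N.
    by rewrite expn_gt0; apply/orP; left; apply/card_gt0P; exists 0.
  (* The truncated subtractions are exact because [#|b| <= #|F|] and [#|F| ^ k] is positive. *)
  have -> : ((#|F| ^ k.+1 - #|b|) * d
      = #|~: B| * d + (#|F| ^ k - 1) * (#|F| * d))%N.
    rewrite (cardsCs (~: B)) setCK cardB mulnA -mulnDl; congr (_ * _)%N.
    rewrite mulnBl mul1n expnSr.
    have := leq_pmull #|F| q_gt0; move: (_ * _)%N le_bq => m.
    by move: #|F| #|b| => q l; lia.
  exact: gdegM (deg_prod _) deg_G.
move=> xs xsA; set y := f xs; set c0 := rho y.
(* The factor at [c] has residue [c0 - c], so only the factor at [c0] can vanish residually. *)
have prod_neq0 (P : pred F) :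
    (rho (\prod_(c | P c) (y - e c)) != 0) = ~~ P c0.
  rewrite rmorph_prod prodf_seq_neq0.
  apply/allP/idP => [all_neq|nP c _]; last first.
    apply/implyP => Pc; rewrite rho_factor subr_eq0.
    by apply: contraNneq nP => c0E; rewrite /c0 /y c0E.
  apply/negP => Pc0; have /implyP/(_ Pc0) := all_neq _ (mem_index_enum c0).
  by rewrite rho_factor subrr eqxx.
(* The product without the factor at [c0] is a unit, so [a * Q xs] and [y - e c0] are divisible by
   the same powers of [a]; then one factor [a] is cancelled. *)
have Q_divides : divides (a ^+ k) (Q xs) <-> divides (a ^+ k.+1) (y - e c0).
  rewrite -dividesS_cancel // -QE // (bigD1 c0) //=; split=> [[t tE]|[t ->]]; last first.
    by exists (t * \prod_(c | c != c0) (y - e c)); rewrite mulrA.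
  have [|u uE] := @residue_unit (\prod_(c | c != c0) (y - e c)).
    by rewrite prod_neq0 eqxx.
  by exists (t * u); rewrite mulrA -tE -mulrA uE mulr1.
rewrite rmorphM mulf_eq0 negb_or prod_neq0 inE negbK.
split=> [/andP[/imsetP[b0 b0b c0E] /(GE _ xsA)/Q_divides]|[b0 b0b]].
  by rewrite c0E e_b // => div_b0; exists b0.
(* The exponent [k.+1] is positive, so the divisibility already forces equal residues, and [e]
   returns [b0] itself. *)
move=> div_b0; have c0E : c0 = rho b0.
  apply/eqP; rewrite -subr_eq0 -rmorphB; apply/eqP/ker_rho.
  by case: div_b0 => t ->; exists (a ^+ k * t); rewrite mulrA -exprS.
rewrite c0E imset_f //=; apply/(GE _ xsA)/Q_divides.
by rewrite c0E e_b.
Qed.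

(** The step from [k] to [k.+1] is [set_test] for the one-element set of [0], which has the degree
    factor [#|F| ^ k.+1 - 1]. *)
Lemma power_testP k : (k <= v)%N -> power_test k.
Proof.
elim: k => [_ d f deg_f|k IH lt_kv d f deg_f].
  exists (fun=> 1); first exact: gdeg_const.
  move=> xs _; rewrite rmorph1 oner_neq0; split=> // _.
  by exists (f xs); rewrite mul1r.
have inj0 : {in [set (0 : R)] &, injective rho}.
  by move=> x y /set1P-> /set1P->.
have [G deg_G GE] := set_test (IH (ltnW lt_kv)) lt_kv inj0 deg_f.
rewrite cards1 in deg_G; exists G => // xs /GE ->.
split=> [[b0 /set1P->]|]; first by rewrite subr0.
by exists 0; rewrite ?set11 ?subr0.
Qed.

End Uniformizer.

(** * Powers of a principal ideal *)

Section PrincipalPowers.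
Variable R : finComNzRingType.

Lemma principalP (a y : R) : reflect (divides a y) (y \in [set x * a | x : R]).
Proof.
by apply: (iffP imsetP) => [[z _ ->]|[z ->]]; exists z; rewrite // mulrC.
Qed.

Lemma principal_is_ideal (a : R) : is_ideal [set x * a | x : R].
Proof.
apply/and3P; split.
- by apply/principalP; exists 0; rewrite mulr0.
- apply/forall_inP => _ /principalP[x ->]; apply/forall_inP => _ /principalP[y ->].
  by apply/principalP; exists (x + y); rewrite mulrDr.
- apply/forallP => c; apply/forall_inP => _ /principalP[x ->].
  by apply/principalP; exists (c * x); rewrite mulrCA.
Qed.

Lemma ideal_gen_min (A I : {set R}) :
  is_ideal I -> A \subset I -> ideal_gen A \subset I.
Proof. by move=> idI AI; apply: (bigcap_inf I); rewrite ?idI. Qed.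

Lemma sub_ideal_gen (A : {set R}) : A \subset ideal_gen A.
Proof. by apply/bigcapsP => I /andP[]. Qed.

Lemma ideal_gen_mull (A : {set R}) c x : x \in ideal_gen A -> c * x \in ideal_gen A.
Proof.
move=> /bigcapP xA; apply/bigcapP => I AI; have /andP[/and3P[_ _ /forallP idI] _] := AI.
by have /forall_inP -> := idI c; rewrite ?xA.
Qed.

Lemma ideal_mul_principal (a b : R) :
  ideal_mul [set x * a | x : R] [set x * b | x : R] = [set x * (a * b) | x : R].
Proof.
apply/eqP; rewrite eqEsubset ideal_gen_min ?principal_is_ideal //=.
  apply/subsetP => _ /imsetP[x _ ->]; apply: ideal_gen_mull.
  apply: (subsetP (sub_ideal_gen _)); apply/imset2P; exists a b => //.
    by apply/principalP; exists 1; rewrite mulr1.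
  by apply/principalP; exists 1; rewrite mulr1.
apply/subsetP => _ /imset2P[_ _ /principalP[x ->] /principalP[y ->] ->].
by apply/principalP; exists (x * y); rewrite mulrACA.
Qed.

Lemma ideal_exp_principal (a : R) k :
  ideal_exp [set x * a | x : R] k = [set x * a ^+ k | x : R].
Proof.
elim: k => [|k IH]; last by rewrite exprS -ideal_mul_principal -IH.
apply/setP => x; rewrite inE; apply/esym/imsetP; exists x => //.
by rewrite expr0 mulr1.
Qed.

End PrincipalPowers.

(** * Comparing a product with the minimum *)

(** With [y] as the upper bounds, [admissible_ex] yields a tuple below [y] with sum exactly [N],
    hence with no larger product. For [N < n] the minimum is [1] by convention. *)
Lemma minprod_le (n : nat) (a y : 'I_n -> nat) (N : int) :
  (forall i, 0 < y i <= a i)%N -> N <= ((\sum_i y i)%N : int) ->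
  (minprod a N <= \prod_i y i)%N.
Proof.
move=> ya le_Ny; have y_gt0 i : (0 < y i)%N by have /andP[] := ya i.
have a_gt0 i : (0 < a i)%N by have /andP[/leq_trans] := ya i; apply.
have [lt_Nn|] := ltP N n%:Z.
  by rewrite /minprod lt_Nn prodn_gt0.
case: N le_Ny => // N; rewrite !lez_nat => le_Ny le_nN.
have [z /andP[/forallP zy sum_z]] := admissible_ex y_gt0 le_nN le_Ny.
have za i : (0 < z i <= a i)%N.
  have /andP[-> /= le_zy] := zy i; have /andP[_] := ya i; exact: leq_trans.
have le_Na : (N <= \sum_i a i)%N.
  by apply: leq_trans le_Ny _; apply: leq_sum => i _; have /andP[] := ya i.
have [_ /(_ z) le_min] := minprodP a_gt0 le_nN le_Na.
apply: leq_trans (le_min _) _; first by rewrite /admissible sum_z andbT; apply/forallP.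
by apply: leq_prod => i _; have /andP[] := zy i.
Qed.

(** * Points of the box as sequences *)

Section FiniteFunctions.
Variables (R : finComNzRingType) (n : nat) (a : 'I_n -> {set R}).

Definition seq_of_ffun (x : {ffun 'I_n -> R}) := [seq x i | i <- enum 'I_n].

Definition box := [seq enum (a i) | i <- enum 'I_n].

Lemma nth_seq_of_ffun x (i : 'I_n) : (seq_of_ffun x)`_i = x i.
Proof. by rewrite (nth_map i) ?size_enum_ord // nth_ord_enum. Qed.

Lemma size_box : size box = n. Proof. by rewrite size_map size_enum_ord. Qed.

Lemma nth_box (i : 'I_n) : nth [::] box i = enum (a i).
Proof. by rewrite (nth_map i) ?size_enum_ord // nth_ord_enum. Qed.

Lemma seq_of_ffun_grid x : (seq_of_ffun x \in grid box) = [forall i, x i \in a i].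
Proof.
apply/grid_nthP/forallP => [[_ xa] i|xa].
  have := xa i; rewrite size_box nth_seq_of_ffun nth_box mem_enum; exact.
split=> [|i]; first by rewrite !size_map.
rewrite size_box => lt_in; rewrite -[i]/(nat_of_ord (Ordinal lt_in)).
by rewrite nth_seq_of_ffun nth_box mem_enum.
Qed.

Lemma seq_of_ffun_surj xs : xs \in grid box ->
  seq_of_ffun [ffun i : 'I_n => xs`_i] = xs.
Proof.
move=> /grid_nthP[sz_xs _]; rewrite size_box in sz_xs.
apply: (@eq_from_nth _ 0); rewrite size_map size_enum_ord // => i lt_in.
by rewrite -[i]/(nat_of_ord (Ordinal lt_in)) nth_seq_of_ffun ffunE.
Qed.

Lemma count_box (P : pred (seq R)) :
  count P (grid box)
    = #|[set x : {ffun 'I_n -> R} | [forall i, x i \in a i] && P (seq_of_ffun x)]|.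
Proof.
rewrite -size_filter cardE -(size_map seq_of_ffun); apply/perm_size/uniq_perm.
- rewrite filter_uniq // grid_uniq // all_map.
  by apply/allP => i _; apply: enum_uniq.
- rewrite map_inj_uniq ?enum_uniq // => x y xy; apply/ffunP => i.
  by rewrite -!nth_seq_of_ffun xy.
move=> xs; rewrite mem_filter; apply/andP/mapP => [[Pxs xsA]|[x]].
  exists [ffun i : 'I_n => xs`_i]; last by rewrite seq_of_ffun_surj.
  by rewrite mem_enum inE -seq_of_ffun_grid seq_of_ffun_surj // xsA.
by rewrite mem_enum inE -seq_of_ffun_grid => /andP[xA Px] ->.
Qed.

End FiniteFunctions.

(** * Assembling the tests and counting solutions *)

Theorem theorem1p6
    (R : finComNzRingType) (p : idealr R) (v q : nat) (F : finFieldType)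
    (phi : {rmorphism {ideal_quot p} -> F})
    (R_principal : principal_ring R)
    (R_local : local_ring_with [set x : R | x \in p])
    (R_length : ring_length [set x : R | x \in p] v)
    (F_card : #|F| = q) (phi_bij : bijective phi)
    (n r : nat) (n_gt0 : (0 < n)%N) (r_gt0 : (0 < r)%N)
    (vs : 'I_r -> nat) (vs_bound : forall j, (1 <= vs j <= v)%N)
    (a : 'I_n -> {set R}) (b : 'I_r -> {set R})
    (a_neq0 : forall i, a i != set0) (b_neq0 : forall j, b j != set0)
    (a_incongr : forall i, incongruent_mod (a i) [set x : R | x \in p])
    (b_incongr : forall j, incongruent_mod (b j) [set x : R | x \in p])
    (f : 'I_r -> {mpoly R[n]}) :
  let z := [set x : {ffun 'I_n -> R} |
             [forall i, x i \in a i] &&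
             [forall j, in_mod (f j).@[x] (b j)
                               (ideal_exp [set y : R | y \in p] (vs j))]] in
  z = set0 \/
  (minprod (fun i => #|a i|)
     ((\sum_i #|a i|%:Z)
      - \sum_j ((q ^ vs j)%N%:Z - #|b j|%:Z) * (tdeg (f j))%:Z)
   <= #|z|)%N.
Proof.
move=> z; case: R_length => v_gt0.
have [pi pE] : exists pi, [set x : R | x \in p] = [set x * pi | x : R].
  apply: R_principal; apply/and3P; split; first by rewrite inE idealr0.
    apply/forall_inP => x; rewrite inE => xp; apply/forall_inP => y.
    by rewrite !inE => yp; apply: rpredD.
  by apply/forallP => c; apply/forall_inP => x; rewrite !inE; apply: idealMr.
(* This turns the length of the ring into the nilpotency index of [pi]. *)
have zero_ideal k : ideal_exp [set x : R | x \in p] k = [set 0] <-> pi ^+ k = 0.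
  rewrite pE ideal_exp_principal; split=> [/setP/(_ (pi ^+ k))|->].
    rewrite inE => pikE; apply/eqP; rewrite -pikE; apply/principalP.
    by exists 1; rewrite mulr1.
  apply/setP => x; rewrite inE; apply/principalP/eqP => [[y ->]|->].
    by rewrite mul0r.
  by exists 0; rewrite mul0r.
move=> /eqP/zero_ideal/eqP piX_neq0 /zero_ideal piX0.
pose rho : {rmorphism R -> F} := phi \o \pi_({ideal_quot p})%qT.
have rho0 x : (rho x == 0) = (x \in p).
  rewrite -[x in RHS]subr0 Quotient.idealrBE -(bij_eq phi_bij) /=.
  by rewrite [(\pi 0)%qT]rmorph0 rmorph0.
have ker_rho x : rho x = 0 <-> divides pi x.
  split=> [/eqP|/principalP]; last by rewrite -pE inE -rho0 => /eqP.
  by rewrite rho0 => xp; apply/principalP; rewrite -pE inE.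
have rho_surj c : exists x, rho x = c.
  case: phi_bij => psi _ psiK; exists (repr (psi c)).
  by rewrite /= reprK psiK.
have rho_inj (B : {set R}) : incongruent_mod B [set x : R | x \in p] ->
    {in B &, injective rho}.
  move=> B_incongr x y xB yB xy; apply: B_incongr => //.
  by rewrite inE -rho0 rmorphB xy subrr.
have A_uniq : residually_uniq rho (box a).
  rewrite /residually_uniq all_map; apply/allP => i _ /=.
  rewrite map_inj_in_uniq ?enum_uniq // => x y; rewrite !mem_enum.
  exact: (rho_inj _ (a_incongr i)).
have /fin_all_exists[G GP] (j : 'I_r) : exists G,
    gdeg (box a) ((q ^ vs j - #|b j|) * tdeg (f j)) G /\
    {in grid (box a), forall xs, rho (G xs) != 0 <->
       exists2 b0, b0 \in b j
         & divides (pi ^+ vs j) ((f j).@[fun i => xs`_i] - b0)}.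
  (* The bound excludes exponent [0] and, for [vs j = k.+1], reads [k < v]. *)
  case: (vs j) (vs_bound j) => // k lt_kv.
  have [G deg_G GE] := set_test rho_surj ker_rho v_gt0 piX0 piX_neq0 A_uniq
    (power_testP rho_surj ker_rho v_gt0 piX0 piX_neq0 A_uniq (ltnW lt_kv))
    lt_kv (rho_inj _ (b_incongr j)) (gdeg_meval _ (f j)).
  by exists G; rewrite -F_card.
(* Over a field a product is nonzero iff all its factors are, so the residual nonzeros of [P] on the
   box are exactly the points of [z]. *)
pose P xs := \prod_j G j xs.
have deg_P : gdeg (box a) (\sum_j (q ^ vs j - #|b j|) * tdeg (f j)) P.
  by apply: gdeg_prod => j _; have [] := GP j.
have zE : #|z| = count (fun xs => rho (P xs) != 0) (grid (box a)).
  rewrite count_box; apply: eq_card => x; rewrite !inE.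
  apply: andb_id2l; rewrite -seq_of_ffun_grid => xA.
  have fE j : (f j).@[fun i => (seq_of_ffun x)`_i] = (f j).@[x].
    by apply: meval_eq => i; rewrite nth_seq_of_ffun.
  rewrite rmorph_prod prodf_seq_neq0 /=.
  apply/forallP/allP => [zx j _|Gx j].
    have [_ /(_ _ xA) -> /=] := GP j; rewrite fE.
    have /exists_inP[b0 b0b b0P] := zx j; exists b0 => //.
    by apply/principalP; rewrite -ideal_exp_principal -pE.
  have [_ /(_ _ xA) [/(_ (Gx j (mem_index_enum j)))]] := GP j.
  rewrite fE => -[b0 b0b /principalP]; rewrite -ideal_exp_principal -pE => b0P _.
  by apply/exists_inP; exists b0.
have [P_neq0|P_eq0] := boolP (has (fun xs => rho (P xs) != 0) (grid (box a))); last first.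
  by left; apply/eqP; rewrite -cards_eq0 zE eqn0Ngt -has_count.
right; have [y [sz_y ya sum_y prod_y]] := alon_furedi A_uniq deg_P P_neq0.
rewrite size_box in sz_y ya.
have le_ya (i : 'I_n) : (0 < nth 0 y i <= #|a i|)%N.
  by rewrite cardE -nth_box ya.
apply: leq_trans (minprod_le le_ya _) _; last first.
  by rewrite zE; apply: leq_trans _ prod_y; rewrite (big_nth 0%N) sz_y big_mkord.
have sum_a : sumn (map size (box a)) = (\sum_i #|a i|)%N.
  by rewrite sumnE -map_comp big_map big_enum; apply: eq_bigr => i _; rewrite /= cardE.
have {}sum_y : (\sum_i #|a i| <= \sum_(i < n) nth 0 y i
     + \sum_j (q ^ vs j - #|b j|) * tdeg (f j))%N.
  by rewrite -sum_a (leq_trans sum_y) // sumnE (big_nth 0%N) sz_y big_mkord.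
(* This makes the truncated subtraction in the degree of [P] agree with the integer one in the
   statement. *)
have le_bq j : (#|b j| <= q ^ vs j)%N.
  have /andP[vj_gt0 _] := vs_bound j.
  rewrite -(card_in_imset (rho_inj _ (b_incongr j))).
  apply: leq_trans (max_card _) _; rewrite F_card -{1}(expn1 q) leq_pexp2l //.
  by rewrite -F_card; apply/card_gt0P; exists 0.
have -> : \sum_j ((q ^ vs j)%N%:Z - #|b j|%:Z) * (tdeg (f j))%:Z
    = (\sum_j (q ^ vs j - #|b j|) * tdeg (f j))%N%:Z.
  rewrite (big_morph Posz PoszD (erefl _)); apply: eq_bigr => j _.
  by rewrite PoszM -subzn.
by rewrite lerBlDr -PoszD -(big_morph Posz PoszD (erefl _)) lez_nat.
Qed.
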